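(* 1. Let $H$ be a strongly primary monoid. (a) If $\Lambda(H)<\infty$, then $H$ is locally tame, but not globally tame. (b) If $\Lambda(H)=\infty$ and $(H:\widehat H)\ne\emptyset$, then $H$ is globally tame. (c) $H$ is locally tame if either $\Lambda(H)<\infty$ or $(H:\widehat H)\ne\emptyset$. 2. Let $R$ be a strongly primary domain. (a) $R$ is locally tame. (b) $R$ is globally tame if and only if $\Lambda(R)=\infty$.
   Context: A monoid is a commutative cancellative semigroup with identity; a domain is a commutative integral domain. $\mathbb N=\{1,2,\dots\}$, $\mathbb N_0=\mathbb N\cup\{0\}$. For a monoid $H$: $H^\times$ is the unit group, $\mathfrak m=H\setminus H^\times$, $\mathsf q(H)$ the quotient group, $\mathcal A(H)$ the set of atoms (irreducible elements), $H_{\rm red}=\{aH^\times:a\in H\}$. The complete integral closure is $\widehat H=\{x\in\mathsf q(H):\exists c\in H,\ cx^n\in H\ \forall n\in\mathbb N\}$, and $(H:\widehat H)=\{z\in\mathsf q(H):z\widehat H\subseteq H\}$. $H$ is strongly primary if $H\ne H^\times$ and for every $a\in\mathfrak m$ there is $n\in\mathbb N$ with $\mathfrak m^n\subseteq aH$ ($\mathfrak m^n$ = set of products of $n$ elements of $\mathfrak m$). Strongly primary monoids are atomic. $\mathsf Z(H)$ is the free abelian monoid on $\mathcal A(H_{\rm red})$, $\pi:\mathsf Z(H)\to H_{\rm red}$ the canonical homomorphism, $\mathsf Z(a)=\pi^{-1}(aH^\times)$, $|z|$ the length of $z\in\mathsf Z(H)$, and $\mathsf L(a)=\{|z|:z\in\mathsf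 Z(a)\}\subseteq\mathbb N_0$. For $z,z'\in\mathsf Z(H)$, after cancelling their greatest common divisor in $\mathsf Z(H)$ they become products of $m$ and $n$ atoms respectively, and $\mathsf d(z,z')=\max\{m,n\}$. $\Lambda(H)=\sup\{\min\mathsf L(a):a\in H\}\in\mathbb N_0\cup\{\infty\}$. For $u\in\mathcal A(H_{\rm red})$, $\mathsf t(u)$ is the smallest $N\in\mathbb N_0\cup\{\infty\}$ such that whenever $a\in H$ with $\mathsf Z(a)\cap u\mathsf Z(H)\ne\emptyset$ and $z\in\mathsf Z(a)$, there is $z'\in\mathsf Z(a)\cap u\mathsf Z(H)$ with $\mathsf d(z,z')\le N$. $H$ is locally tame if $\mathsf t(u)<\infty$ for all $u\in\mathcal A(H_{\rm red})$, and globally tame if $\sup\{\mathsf t(u):u\in\mathcal A(H_{\rm red})\}<\infty$. For a domain $R$, all these notions (strongly primary, locally tame, globally tame, $\Lambda(R)$) are those of the multiplicative monoid $R^\bullet=R\setminus\{0\}$. *)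

(* Defs.v *)
From HB Require Import structures.
From mathcomp Require Import all_boot all_order ssralg.
From mathcomp Require Import finmap multiset.
From mathcomp Require Import boolp classical_sets.

Set Implicit Arguments.
Unset Strict Implicit.
Unset Printing Implicit Defensive.

Local Open Scope mset_scope.
Local Open Scope classical_set_scope.
Local Open Scope quotient_scope.
Local Open Scope group_scope.

HB.mixin Record Monoid_isComCancel H of Monoid H := {
  cmulC : commutative (@mul H);
  cmulI : right_injective (@mul H)
}.

#[short(type="cmonoidType")]
HB.structure Definition CMonoid := {H of Monoid_isComCancel H & Monoid H}.

Bind Scope group_scope with CMonoid.sort.

Section CMonoidTheory.
Variable H : cmonoidType.
Implicit Types a b c d : H.

Lemma cmulCA a b c : a * (b * c) = b * (a * c).
Proof. by rewrite mulgA (cmulC a) -mulgA. Qed.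

Lemma cmulACA a b c d : (a * b) * (c * d) = (a * c) * (b * d).
Proof. by rewrite -!mulgA (cmulCA b). Qed.

End CMonoidTheory.

Section Basic.
Variable H : cmonoidType.
Implicit Types (a b c : H) (S : set H).

Definition units : set H := [set a | exists b, a * b = 1].

Definition maxideal : set H := ~` units.

(* The set aS; in particular [translate a setT] is the ideal aH and
   [translate a units] is the coset of a modulo the units. *)
Definition translate a S : set H := [set a * x | x in S].

Definition atoms : set H :=
  [set a | maxideal a /\ forall b c, a = b * c -> units b \/ units c].

Definition power S (n : nat) : set H :=
  [set \prod_(i < n) s i | s in [set s : 'I_n -> H | forall i, S (s i)]].

Definition strongly_primary : Prop :=
  units <> setT /\
  forall a, maxideal a ->
    exists n : nat, (0 < n)%N /\ power maxideal n `<=` translate a setT.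

Lemma units1 : units 1.
Proof. by exists 1; rewrite mulg1. Qed.

Lemma unitsM a b : units a -> units b -> units (a * b).
Proof. by move=> [x ax] [y by_]; exists (x * y); rewrite cmulACA ax by_ mulg1. Qed.

Lemma translate_unitsP a b :
  translate a units = translate b units <-> exists2 u, units u & b = a * u.
Proof.
split=> [E | [u [v uv] ->]].
  have : translate b units b by exists 1; [exact: units1 | rewrite mulg1].
  by rewrite -E => -[u uu <-]; exists u.
apply/seteqP; split=> _ [w ww <-].
  exists (v * w); first by apply: unitsM => //; exists u; rewrite cmulC.
  by rewrite -mulgA (mulgA u) uv mul1g.
exists (u * w); last by rewrite mulgA.
by apply: unitsM => //; exists v.
Qed.

End Basic.

Section Reduced.
Variable H : cmonoidType.
Implicit Types a b : H.

(* H_red is the set of cosets aH^x, realized as the quotient of H by the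
   relation aH^x = bH^x. *)
Definition assoc : rel H :=
  fun a b => `[< translate a (@units H) = translate b (@units H) >].

Lemma assoc_refl : reflexive assoc.
Proof. by move=> a; apply/asboolP. Qed.

Lemma assoc_sym : symmetric assoc.
Proof. by move=> a b; apply/asboolP/asboolP. Qed.

Lemma assoc_trans : transitive assoc.
Proof. by move=> b a c /asboolP ab /asboolP bc; apply/asboolP; rewrite ab. Qed.

Canonical assoc_equiv := EquivRel assoc assoc_refl assoc_sym assoc_trans.

Definition reduced : Type := {eq_quot assoc}.

HB.instance Definition _ : EqQuotient H assoc reduced := EqQuotient.on reduced.
HB.instance Definition _ := Choice.on reduced.

Definition red_one : reduced := \pi_reduced 1.
Definition red_mul : reduced -> reduced -> reduced :=
  lift_op2 reduced (fun a b : H => a * b).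

Lemma pi_redP a b :
  \pi_reduced a = \pi_reduced b <-> exists2 u, units u & b = a * u.
Proof.
rewrite -translate_unitsP; split; first by move/eqmodP/asboolP.
by move=> E; apply/eqmodP/asboolP.
Qed.

Lemma pi_red_mul : {morph \pi_reduced : a b / a * b >-> red_mul a b}.
Proof.
move=> a b; unlock red_mul; apply/pi_redP.
have /pi_redP[u uu ->] : \pi_reduced a = \pi_reduced (repr (\pi_reduced a)).
  by rewrite reprK.
have /pi_redP[v vv ->] : \pi_reduced b = \pi_reduced (repr (\pi_reduced b)).
  by rewrite reprK.
by exists (u * v); [exact: unitsM | rewrite cmulACA].
Qed.
Canonical pi_red_mul_morph := PiMorph2 pi_red_mul.

Lemma red_mulA : associative red_mul.
Proof.
by elim/quotW=> a; elim/quotW=> b; elim/quotW=> c; rewrite !piE mulgA.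
Qed.

Lemma red_mul1 : left_id red_one red_mul.
Proof. by elim/quotW=> a; rewrite /red_one !piE mul1g. Qed.

Lemma red_mulr1 : right_id red_one red_mul.
Proof. by elim/quotW=> a; rewrite /red_one !piE mulg1. Qed.

HB.instance Definition _ :=
  isMonoid.Build reduced red_mulA red_mul1 red_mulr1.

Lemma red_mulC : commutative (@mul reduced).
Proof.
elim/quotW=> a; elim/quotW=> b.
by rewrite -[LHS]pi_red_mul -[RHS]pi_red_mul cmulC.
Qed.

Lemma red_mulI : right_injective (@mul reduced).
Proof.
elim/quotW=> a; elim/quotW=> b; elim/quotW=> c.
rewrite -[X in X = _ -> _]pi_red_mul -[X in _ = X -> _]pi_red_mul.
move=> /pi_redP[u uu]; rewrite -mulgA => /cmulI ->.
by apply/pi_redP; exists u.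
Qed.

HB.instance Definition _ := Monoid_isComCancel.Build reduced red_mulC red_mulI.

End Reduced.

Section QuotientGroup.
Variable H : cmonoidType.
Implicit Types x y z : H * H.

(* The pair (a, b) stands for the fraction a / b. *)
Definition eqfrac : rel (H * H) := fun x y => x.1 * y.2 == y.1 * x.2.

Lemma eqfrac_refl : reflexive eqfrac.
Proof. by move=> x; exact: eqxx. Qed.

Lemma eqfrac_sym : symmetric eqfrac.
Proof. by move=> x y; exact: eq_sym. Qed.

Lemma eqfrac_trans : transitive eqfrac.
Proof.
move=> [c d] [a b] [e f] /eqP /= xy /eqP /= yz; apply/eqP/(@cmulI H d) => /=.
by rewrite cmulCA mulgA xy (cmulCA d) (mulgA e) -yz -!mulgA (cmulC b).
Qed.

Canonical eqfrac_equiv := EquivRel eqfrac eqfrac_refl eqfrac_sym eqfrac_trans.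

Definition qgroup : Type := {eq_quot eqfrac}.

HB.instance Definition _ : EqQuotient (H * H)%type eqfrac qgroup :=
  EqQuotient.on qgroup.
HB.instance Definition _ := Choice.on qgroup.

Definition toq (a : H) : qgroup := \pi_qgroup (a, 1).

Definition q_one : qgroup := \pi_qgroup (1, 1).
Definition q_mul : qgroup -> qgroup -> qgroup :=
  lift_op2 qgroup (fun x y => (x.1 * y.1, x.2 * y.2)).
Definition q_inv : qgroup -> qgroup := lift_op1 qgroup (fun x => (x.2, x.1)).

Lemma pi_qP x y : \pi_qgroup x = \pi_qgroup y <-> x.1 * y.2 = y.1 * x.2.
Proof.
by split=> [/eqmodP/eqP // | E]; apply/eqmodP/eqP.
Qed.

Lemma repr_qE x :
  x.1 * (repr (\pi_qgroup x)).2 = (repr (\pi_qgroup x)).1 * x.2.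
Proof. by apply/pi_qP; rewrite reprK. Qed.

Lemma pi_q_mul :
  {morph \pi_qgroup : x y / (x.1 * y.1, x.2 * y.2) >-> q_mul x y}.
Proof.
move=> x y; unlock q_mul; apply/pi_qP => /=.
by rewrite cmulACA !repr_qE cmulACA.
Qed.
Canonical pi_q_mul_morph := PiMorph2 pi_q_mul.

Lemma pi_q_inv : {morph \pi_qgroup : x / (x.2, x.1) >-> q_inv x}.
Proof.
move=> x; unlock q_inv; apply/pi_qP => /=.
by rewrite cmulC -repr_qE cmulC.
Qed.
Canonical pi_q_inv_morph := PiMorph1 pi_q_inv.

Lemma q_mulA : associative q_mul.
Proof.
by elim/quotW=> x; elim/quotW=> y; elim/quotW=> z; rewrite !piE /= !mulgA.
Qed.

Lemma q_mul1 : left_id q_one q_mul.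
Proof.
by elim/quotW=> -[a b]; rewrite /q_one !piE /= !mul1g.
Qed.

Lemma q_mulr1 : right_id q_one q_mul.
Proof.
by elim/quotW=> -[a b]; rewrite /q_one !piE /= !mulg1.
Qed.

Lemma q_mulV : left_inverse q_one q_inv q_mul.
Proof.
elim/quotW=> -[a b]; rewrite /q_one !piE.
by apply/pi_qP; rewrite /= mulg1 mul1g cmulC.
Qed.

Lemma q_mulrV : right_inverse q_one q_inv q_mul.
Proof.
elim/quotW=> -[a b]; rewrite /q_one !piE.
by apply/pi_qP; rewrite /= mulg1 mul1g cmulC.
Qed.

HB.instance Definition _ :=
  isGroup.Build qgroup q_mulA q_mul1 q_mulr1 q_mulV q_mulrV.

Lemma q_mulC : commutative (@mul qgroup).
Proof.
elim/quotW=> x; elim/quotW=> y; rewrite -[LHS]pi_q_mul -[RHS]pi_q_mul.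
by rewrite cmulC (cmulC x.2).
Qed.

Lemma toq_inj : injective toq.
Proof. by move=> a b /pi_qP /=; rewrite !mulg1. Qed.

Lemma toqM : {morph toq : a b / a * b}.
Proof. by move=> a b; rewrite -[RHS]pi_q_mul /= mulg1. Qed.

Definition cint_closure : set qgroup :=
  [set x | exists c : H, forall n : nat, (0 < n)%N ->
     range toq (toq c * x ^+ n)].

(* (H : H^), where H^ is the complete integral closure. *)
Definition conductor : set qgroup :=
  [set z | [set z * x | x in cint_closure] `<=` range toq].

End QuotientGroup.

Arguments conductor : clear implicits.

(* [Some n] is the natural number n, [None] is infinity. *)
Definition enat : Type := option nat.

HB.instance Definition _ := Choice.on enat.

Definition enat_le (x y : enat) : bool :=
  if y isn't Some n then true else if x is Some m then (m <= n)%N else false.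

Fact enat_display : Order.disp_t. Proof. exact: Order.Disp tt tt. Qed.

Lemma enat_le_refl : reflexive enat_le.
Proof. by case=> [n|] //=. Qed.

Lemma enat_le_anti : antisymmetric enat_le.
Proof. by case=> [m|] [n|] //= /anti_leq ->. Qed.

Lemma enat_le_trans : transitive enat_le.
Proof. by case=> [m|] [n|] [p|] //=; exact: leq_trans. Qed.

Lemma enat_le_total : total enat_le.
Proof. by case=> [m|] [n|] //=; exact: leq_total. Qed.

HB.instance Definition _ := Order.Le_isPOrder.Build enat_display enat
  enat_le_refl enat_le_anti enat_le_trans.
HB.instance Definition _ :=
  Order.POrder_isTotal.Build enat_display enat enat_le_total.

Lemma enat_leE (x y : enat) : (x <= y)%O = enat_le x y.
Proof. by []. Qed.

Lemma enat_ge0 (x : enat) : (Some 0 <= x :> enat)%O.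
Proof. by case: x. Qed.

Lemma enat_ley (x : enat) : (x <= None :> enat)%O.
Proof. by case: x. Qed.

HB.instance Definition _ := Order.hasBottom.Build enat_display enat enat_ge0.
HB.instance Definition _ := Order.hasTop.Build enat_display enat enat_ley.

Notation "∞" := (Order.top : enat).

Definition enat_sup (A : set enat) : enat := supremum (Order.bottom : enat) A.

Definition enat_inf (A : set enat) : enat := infimum ∞ A.

(* Every subset of N u {oo} has a supremum, and the infimum of a nonempty one
   is its least element. *)
Lemma enat_least (A : set enat) : A !=set0 -> exists2 x, A x & lbound A x.
Proof.
move=> [x Ax]; pose P n := `[< A (Some n) >].
have [exP|noA] := pselect (exists n, P n).
  case: (ex_minnP exP) => m /asboolP Am mP.
  by exists (Some m) => // -[k|] // Ak; apply: mP; exact/asboolP.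
case: x Ax => [n An|Ax]; first by case: noA; exists n; exact/asboolP.
by exists None => // -[k|//] Ak; case: noA; exists k; exact/asboolP.
Qed.

Lemma enat_infP (A : set enat) :
  A !=set0 -> A (enat_inf A) /\ lbound A (enat_inf A).
Proof.
move=> A0; have [x Ax lx] := enat_least A0.
have inf_x : infimums A x by split=> // y /(_ _ Ax).
rewrite /enat_inf /infimum ifF; last exact/negbTE/set0P.
by rewrite (is_subset1_infimums (xgetPex _ (ex_intro _ x inf_x)) inf_x).
Qed.

Lemma enat_inf0 : enat_inf set0 = ∞.
Proof. by rewrite /enat_inf /infimum eqxx. Qed.

Lemma enat_supP (A : set enat) : isLub A (enat_sup A).
Proof.
have [-> |/set0P A0] := eqVneq A set0.
  rewrite /enat_sup supremum0; split=> // y _; exact: enat_ge0.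
have [x ux lx] : exists2 x, ubound A x & lbound (ubound A) x.
  by apply: enat_least; exists ∞ => y _; exact: enat_ley.
have sup_x : supremums A x by [].
rewrite /enat_sup /supremum ifF; last exact/negbTE/set0P.
by rewrite (is_subset1_supremums (xgetPex _ (ex_intro _ x sup_x)) sup_x).
Qed.

Section Factorizations.
Variable H : cmonoidType.
Implicit Types (a : H).

Definition red_atom : Type := {u : reduced H | `[< atoms u >]}.

HB.instance Definition _ := Choice.on red_atom.

Implicit Types (z : {mset red_atom}) (u : red_atom).

(* [{mset red_atom}] is the free abelian monoid Z(H) on the atoms of H_red,
   with [`+`] as multiplication and [`&`] as gcd, and [factorization_prod] is the
   canonical homomorphism Z(H) -> H_red. *)
Definition factorization_prod z : reduced H := \prod_(u <- enum_mset z) val u.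

Definition factorizations a : set {mset red_atom} :=
  [set z | factorization_prod z = \pi_(reduced H) a].

Definition flength z : nat := size (enum_mset z).

Definition lengths a : set nat := [set flength z | z in factorizations a].

Definition distance z z' : nat :=
  let g := (z `&` z')%mset in
  maxn (flength (z `\` g)%mset) (flength (z' `\` g)%mset).

Definition min_length a : enat := enat_inf [set (Some n : enat) | n in lengths a].

Definition Lambda : enat := enat_sup [set min_length a | a in setT].

(* uZ(H): [+`] adds one copy of u. *)
Definition multiples u : set {mset red_atom} := [set u +` y | y in setT].

Definition tame_degree u : enat :=
  enat_inf [set N : enat | forall a z,
    factorizations a `&` multiples u !=set0 -> factorizations a z ->
    exists2 z', (factorizations a `&` multiples u) z'
              & (Some (distance z z') <= N :> enat)%O].

Definition locally_tame : Prop := forall u, (tame_degree u < ∞)%O.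

Definition globally_tame : Prop :=
  (enat_sup [set tame_degree u | u in setT] < ∞)%O.

End Factorizations.

Section NonzeroMonoid.
Local Open Scope ring_scope.
Import GRing.Theory.
Variable R : idomainType.

Definition nonzero : Type := {x : R | x != 0}.

HB.instance Definition _ := Choice.on nonzero.
HB.instance Definition _ := SubType.on nonzero.

Implicit Types x y z : nonzero.

Definition nz_one : nonzero := Sub 1 (oner_neq0 R).

Lemma nz_mul_subproof x y : val x * val y != 0.
Proof. by rewrite mulf_neq0 ?(valP x) ?(valP y). Qed.

Definition nz_mul x y : nonzero := Sub (val x * val y) (nz_mul_subproof x y).

Lemma nz_mulA : associative nz_mul.
Proof. by move=> x y z; apply: val_inj; rewrite !SubK mulrA. Qed.

Lemma nz_mul1 : left_id nz_one nz_mul.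
Proof. by move=> x; apply: val_inj; rewrite !SubK mul1r. Qed.

Lemma nz_mulr1 : right_id nz_one nz_mul.
Proof. by move=> x; apply: val_inj; rewrite !SubK mulr1. Qed.

HB.instance Definition _ := isMonoid.Build nonzero nz_mulA nz_mul1 nz_mulr1.

Lemma nz_mulC : commutative (@mul nonzero).
Proof. by move=> x y; apply: val_inj; rewrite !SubK mulrC. Qed.

Lemma nz_mulI : right_injective (@mul nonzero).
Proof.
move=> x y z /(congr1 val); rewrite !SubK => /(mulfI (valP x)).
exact: val_inj.
Qed.

HB.instance Definition _ := Monoid_isComCancel.Build nonzero nz_mulC nz_mulI.

End NonzeroMonoid.

(* Main.v *)
From HB Require Import structures.
Require Import Defs.
From mathcomp Require Import all_boot all_order ssralg.
From mathcomp Require Import finmap multiset.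
From mathcomp Require Import boolp classical_sets.
From mathcomp Require Import zify.

Set Implicit Arguments.
Unset Strict Implicit.
Unset Printing Implicit Defensive.

Local Open Scope mset_scope.
Local Open Scope quotient_scope.
Local Open Scope classical_set_scope.
Local Open Scope group_scope.

(**
The proof never enters the quotient group: a fraction [b / a] is handled through
divisibility in [H].  Fix a nonunit [q] of a strongly primary monoid, and let
[M] be such that every product of [M] nonunits is divisible by [q].  An element
divisible by a power of [q] only up to a bounded exponent is a product of
boundedly many atoms, because it cannot be a product of many nonunits.  As every
element is [q ^+ k * b] with [b] not divisible by [q], finiteness of Lambda only
depends on the powers of [q]: Lambda is finite as soon as all the [q ^+ j] have
factorizations of a common bounded length ([short_powers_Lambda]).

Local tameness follows from a criterion ([tame_degree_le]): the tame degree of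
[u] is finite if [u] divides every product of [n] atoms and the cofactors of [u]
in products of at most [n] atoms have factorizations of bounded length.  When
Lambda is finite the second condition is free.  In that case global tameness
fails: a uniform bound [N] on tame degrees would make every atom that divides
some power of an atom [q] divide [q ^+ N.+1]; writing [q ^+ k] with at most
Lambda atoms, [q ^+ k] would divide a fixed power of [q] for all [k].

Suppose now that [q] conducts the complete integral closure into [H] and that
Lambda is infinite.  Write [adv a b] when [b / a] lies in the complete integral
closure.  For a nonunit [u] let [l] and [L] be the largest and the smallest
exponents with [adv (q ^+ l) (u ^+ k)] and [adv (u ^+ k) (q ^+ L)].  Cancelling
gives [q ^+ (L - l + 2) = x * y] with neither [x] nor [y] divisible by [q ^+ 2],
so [q ^+ (L - l + 2)] has a short factorization.  The gap [L - l] grows by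
bounded steps with [k]; if it were unbounded, all powers of [q] would have short
factorizations.  Hence it is bounded ([adv_gap_bounded]): some power of [u] is,
up to a bounded error, a power of [q], for every exponent.  Since the complete
integral closure is itself completely integrally closed and closed under roots,
an atom [u] (which is not almost divisible by [q ^+ 3]) almost divides [q ^+ 3],
so it divides [q ^+ 4].  This is uniform in [u], and the criterion applies
uniformly.

For a domain it remains to see that an empty conductor forces Lambda to be
finite.  Then there are [x] in the complete integral closure for which the least
[n] with [q ^+ n * x] in [R] is arbitrarily large.  Since these exponents stay
bounded along the powers of [x], for some [x] the least exponent of [x ^+ 2] is
less than twice that of [x] by any prescribed margin
([empty_conductor_square]).  Put [y = q ^+ n * x].  It is not divisible by [q],
and [y ^+ 2] is a multiple of [q ^+ (2 * i).+1]; hence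
[(q ^+ i + y) * (q ^+ i - y)] equals [q ^+ (2 * i)] times a unit, while neither
factor is divisible by [q].  So all even powers of [q] have factorizations of
length at most [M + M].
*)

(** * Divisibility in a commutative cancellative monoid *)

HB.instance Definition _ (H : cmonoidType) :=
  SemiGroup.isCommutativeLaw.Build H mul (@cmulC H).

Section Divisibility.
Context {H : cmonoidType}.
Implicit Types a b c : H.

Definition dvd a b := exists c, b = a * c.

Lemma dvd_refl a : dvd a a.
Proof. by exists 1; rewrite mulg1. Qed.

Lemma dvd1 a : dvd 1 a.
Proof. by exists a; rewrite mul1g. Qed.

Lemma dvd_trans b a c : dvd a b -> dvd b c -> dvd a c.
Proof. by move=> [d ->] [e ->]; exists (d * e); rewrite mulgA. Qed.

Lemma dvd_mulr a b : dvd a (a * b).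
Proof. by exists b. Qed.

Lemma dvd_mull a b : dvd a (b * a).
Proof. by exists b; rewrite cmulC. Qed.

Lemma dvdM a b c d : dvd a b -> dvd c d -> dvd (a * c) (b * d).
Proof. by move=> [e ->] [f ->]; exists (e * f); rewrite cmulACA. Qed.

Lemma dvdX a b n : dvd a b -> dvd (a ^+ n) (b ^+ n).
Proof.
move=> ab; elim: n => [|n IHn]; first exact: dvd_refl.
by rewrite !expgS; exact: dvdM.
Qed.

Lemma dvdI c a b : dvd (c * a) (c * b) -> dvd a b.
Proof. by move=> [d]; rewrite -mulgA => /cmulI ->; exists d. Qed.

Lemma dvd_exp a m n : (m <= n)%N -> dvd (a ^+ m) (a ^+ n).
Proof. by move=> mn; exists (a ^+ (n - m)); rewrite -expgnDr subnKC. Qed.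

Lemma unitsP a : units a <-> dvd a 1.
Proof. by split=> [] [b E]; exists b. Qed.

Lemma dvd_units a b : dvd a b -> units b -> units a.
Proof. by move=> ab /unitsP b1; apply/unitsP/dvd_trans/b1. Qed.

Lemma units_mulIr a b : dvd (a * b) a -> units b.
Proof. by rewrite -[X in dvd _ X]mulg1 => /dvdI /unitsP. Qed.

Lemma maxidealM a b : maxideal a -> maxideal (a * b).
Proof. by move=> na /(dvd_units (dvd_mulr a b)). Qed.

Lemma dvd_exp_leq {a} m n : maxideal a -> dvd (a ^+ m) (a ^+ n) -> (m <= n)%N.
Proof.
move=> na; case: leqP => // nm /(dvd_trans (dvd_exp a nm)).
by rewrite expgSr => /units_mulIr.
Qed.

End Divisibility.

Section Classes.
Context {H : cmonoidType}.
Implicit Types a b c : H.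

(** The projection to [H_red], typed so that the monoid structure of [H_red] is
    found on its values. *)
Definition cls a : reduced H := \pi_(reduced H) a.

Lemma clsM : {morph cls : a b / a * b}.
Proof. exact: pi_red_mul. Qed.

Lemma dvd_cls a b : dvd (cls a) (cls b) <-> dvd a b.
Proof.
split=> [[c]|[c ->]]; last by exists (cls c); exact: clsM.
elim/quotW: c => c; rewrite -[_ * _]clsM => /esym/pi_redP[u uu ->].
by rewrite -mulgA; exact: dvd_mulr.
Qed.

Lemma units_cls a : units (cls a) <-> units a.
Proof. by rewrite !unitsP; exact: dvd_cls. Qed.

Lemma atoms_cls a : atoms a -> atoms (cls a).
Proof.
move=> [na at_a]; split; first by move=> /units_cls.
elim/quotW=> b; elim/quotW=> c.
rewrite -[_ * _]clsM => /pi_redP[u [v uv] /(congr1 (mul^~ v))].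
rewrite -!mulgA uv mulg1 => /esym/at_a[/units_cls|cv]; first by left.
by right; apply/units_cls; apply: dvd_units cv; exact: dvd_mulr.
Qed.

End Classes.

(** * Depth in a strongly primary monoid *)

Section Depth.
Context {H : cmonoidType}.
Implicit Types a b c : H.

(** For positive [n] this is membership in the [n]-th power of the maximal ideal.
    Asking only for divisibility makes it an ideal for [n = 0] too, and makes the
    ideals decreasing in [n]. *)
Definition deep n a :=
  exists s : seq H, [/\ size s = n, forall x, x \in s -> maxideal x
                      & dvd (\prod_(x <- s) x) a].

Lemma deepM m n a b : deep m a -> deep n b -> deep (m + n) (a * b).
Proof.
move=> [s [<- ns sa]] [t [<- nt tb]]; exists (s ++ t).
rewrite size_cat big_cat; split=> //; last exact: dvdM.
by move=> x; rewrite mem_cat => /orP[/ns|/nt].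
Qed.

Lemma deep0 a : deep 0 a.
Proof. by exists [::]; split=> //; rewrite big_nil; exact: dvd1. Qed.

Lemma deep1 a : maxideal a -> deep 1 a.
Proof.
move=> na; exists [:: a]; split=> // [x|]; first by rewrite inE => /eqP->.
by rewrite big_seq1; exact: dvd_refl.
Qed.

Lemma deepX n k a : deep n a -> deep (n * k) (a ^+ k).
Proof.
move=> na; elim: k => [|k IHk]; first by rewrite muln0; exact: deep0.
by rewrite expgS mulnS; exact: deepM.
Qed.

Lemma deep_dvd n a b : dvd a b -> deep n a -> deep n b.
Proof. by move=> ab [s [ss ns sa]]; exists s; split=> //; exact: dvd_trans ab. Qed.

Lemma deep_leq m n a : (m <= n)%N -> deep n a -> deep m a.
Proof.
move=> mn [s [ss ns sa]]; exists (take m s); split.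
- by rewrite size_takel ?ss.
- by move=> x /mem_take /ns.
- by apply: dvd_trans sa; rewrite -{2}(cat_take_drop m s) big_cat; exact: dvd_mulr.
Qed.

Lemma deep_dvdX q M k a :
  (forall b, deep M b -> dvd q b) -> deep (M * k) a -> dvd (q ^+ k) a.
Proof.
move=> Mq; elim: k a => [|k IHk] a; first by move=> _; exact: dvd1.
rewrite mulnS => -[s [ss ns]]; rewrite -(cat_take_drop M s) big_cat => sa.
apply: dvd_trans sa; rewrite expgS; apply: dvdM.
  apply: Mq; exists (take M s); split=> [|x /mem_take/ns //|]; last exact: dvd_refl.
  by rewrite size_takel // ss leq_addr.
apply: IHk; exists (drop M s); split=> [|x /mem_drop/ns //|]; last exact: dvd_refl.
by rewrite size_drop ss addKn.
Qed.

Hypothesis sp : strongly_primary H.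

Lemma strongly_primary_nonunit : exists q : H, maxideal q.
Proof.
apply: contra_notP sp.1 => noq; apply/seteqP; split=> // x _.
by apply: contra_notP noq => nx; exists x.
Qed.

Lemma strongly_primary_dvd a :
  maxideal a -> exists n, forall b, deep n b -> dvd a b.
Proof.
move=> /sp.2[n [_ pn]]; exists n => b [s [ss ns sb]].
have /pn[d _ ad] : power (@maxideal H) n (\prod_(x <- s) x).
  exists (fun i : 'I_n => nth 1 s i).
    by move=> i; apply: ns; rewrite mem_nth ?ss.
  by rewrite (big_nth 1) big_mkord ss.
by apply: dvd_trans sb; rewrite -ad; exact: dvd_mulr.
Qed.

(** If every product of [n] nonunits is a multiple of [a], then [a] cannot be a
    multiple of a product of [n.+1] nonunits: the extra factor would be a unit.
    This is what makes the monoid atomic. *)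
Lemma finite_depth a : exists n, ~ deep n a.
Proof.
have [ua|na] := pselect (units a).
  exists 1%N; case=> -[|x [|y s]] [] // _ ns.
  rewrite big_seq1 => xa; apply: (ns x); first by rewrite mem_head.
  exact: dvd_units ua.
have [n dn] := strongly_primary_dvd na.
exists n.+1; case=> -[|x s] [] // [ss] ns; rewrite big_cons cmulC => sxa.
apply: (ns x); rewrite ?mem_head //; apply: (@units_mulIr _ a).
apply: dvd_trans sxa; apply: dvdM; last exact: dvd_refl.
apply: dn; exists s; split=> //; last exact: dvd_refl.
by move=> y ys; apply: ns; rewrite inE ys orbT.
Qed.

Lemma finite_order q a : maxideal q -> exists n, ~ dvd (q ^+ n) a.
Proof.
move=> nq; have [n dn] := finite_depth a; exists n => qa; apply: dn.
by apply: deep_dvd qa _; have := deepX n (deep1 nq); rewrite mul1n.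
Qed.

Lemma order_decomp q a : maxideal q -> exists k b, a = q ^+ k * b /\ ~ dvd q b.
Proof.
move=> nq; have [n nqa] := finite_order a nq.
have exk : exists k, `[< dvd (q ^+ k) a >].
  by exists 0%N; apply/asboolP; exact: dvd1.
have ubk k : `[< dvd (q ^+ k) a >] -> (k <= n)%N.
  move=> /asboolP qa; rewrite leqNgt; apply/negP => /ltnW nk.
  by apply: nqa; apply: dvd_trans qa; exact: dvd_exp.
case: (ex_maxnP exk ubk) => k /asboolP[b ab] kmax; exists k, b; split=> // qb.
suff /kmax : `[< dvd (q ^+ k.+1) a >] by rewrite ltnn.
by apply/asboolP; rewrite ab expgSr; apply: dvdM => //; exact: dvd_refl.
Qed.

End Depth.

(** * Factorizations and tame degrees *)

Section Factorization.
Context {H : cmonoidType}.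
Implicit Types (a b : H) (z : {mset red_atom H}) (u v : red_atom H).

Lemma enum_msetD z z' :
  perm_eq (enum_mset (z `+` z')%mset) (enum_mset z ++ enum_mset z').
Proof.
by apply/allP => u _; rewrite /= count_cat !count_mem_mset msetE2.
Qed.

Lemma factorization_prodD z z' :
  factorization_prod (z `+` z')%mset = factorization_prod z * factorization_prod z'.
Proof. by rewrite /factorization_prod (perm_big _ (enum_msetD z z')) big_cat. Qed.

Lemma flengthD z z' : flength (z `+` z')%mset = (flength z + flength z')%N.
Proof. by rewrite /flength (perm_size (enum_msetD z z')) size_cat. Qed.

Lemma factorization_prodn n u : factorization_prod (msetn n u) = val u ^+ n.
Proof.
rewrite /factorization_prod enum_msetn.
elim: n => [|n IHn]; first by rewrite big_nil.
by rewrite big_cons IHn expgS.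
Qed.

Lemma flengthn n u : flength (msetn n u) = n.
Proof. by rewrite /flength enum_msetn size_nseq. Qed.

Lemma msubset_flength z z' : (z `<=` z')%mset -> (flength z <= flength z')%N.
Proof.
move=> zz'; suff -> : z' = (z `+` (z' `\` z))%mset by rewrite flengthD leq_addr.
by apply/msetP => u; rewrite !msetE2 subnKC //; exact: (msubsetP zz').
Qed.

(** A common part of two factorizations cancels, so it does not contribute to
    their distance; the gcd may cancel more. *)
Lemma distanceDr z1 z1' z2 :
  (distance (z1 `+` z2)%mset (z1' `+` z2)%mset
     <= maxn (flength z1) (flength z1'))%N.
Proof.
rewrite /distance geq_max !leq_max.
by apply/andP; split; apply/orP; [left|right];
   apply/msubset_flength/msubsetP => u; rewrite !msetE2; lia.
Qed.

(** [min L(a) <= n], stated with a witness so that bounds add up along products. *)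
Definition short n a :=
  exists z : {mset red_atom H}, factorizations a z /\ (flength z <= n)%N.

Lemma short_leq m n a : (m <= n)%N -> short m a -> short n a.
Proof. by move=> mn [z [za zm]]; exists z; split=> //; exact: leq_trans mn. Qed.

Lemma short_cls n a b : cls a = cls b -> short n a -> short n b.
Proof. by move=> ab [z [za zn]]; exists z; split=> //; rewrite /factorizations /= za. Qed.

Lemma shortM m n a b : short m a -> short n b -> short (m + n) (a * b).
Proof.
move=> [z [za zm]] [z' [zb zn]]; exists (z `+` z')%mset.
rewrite flengthD leq_add //; split=> //.
by rewrite /factorizations /= factorization_prodD za zb -clsM.
Qed.

Lemma short_unit a : units a -> short 0 a.
Proof.
move=> [b ab]; exists mset0; rewrite /flength /factorizations /=.
rewrite /factorization_prod enum_mset0 big_nil; split=> //.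
by apply/pi_redP; exists a => //; [exists b|rewrite mul1g].
Qed.

Lemma short_atom a : atoms a -> short 1 a.
Proof.
move=> /atoms_cls/asboolT aa; exists (msetn 1%N (exist _ (cls a) aa)).
by rewrite flengthn; split=> //; rewrite /factorizations /= factorization_prodn.
Qed.

Lemma shortX n k a : short n a -> short (n * k) (a ^+ k).
Proof.
move=> na; elim: k => [|k IHk]; last by rewrite expgS mulnS; exact: shortM.
by rewrite muln0; apply: short_unit; exact: units1.
Qed.

(** A decomposition of [a] into as many nonunits as possible consists of atoms. *)
Lemma not_deep_short n a : ~ deep n.+1 a -> short n a.
Proof.
move=> nda; have [ua|na] := pselect (units a).
  exact: short_leq (short_unit ua).
have exk : exists k, `[< deep k.+1 a >] by exists 0%N; apply/asboolP/deep1.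
have ubk k : `[< deep k.+1 a >] -> (k <= n)%N.
  move=> /asboolP ka; rewrite leqNgt; apply/negP => nk; apply: nda.
  by apply: deep_leq ka; exact: ltnW.
case: (ex_maxnP exk ubk) => k /asboolP ka kmax {exk ubk}.
have kn : (k < n)%N.
  by rewrite ltnNge; apply/negP => nk; apply: nda; apply: deep_leq ka.
apply: short_leq kn _; case: ka => -[|x s] [] // [ss] ns [c ac].
(* The cofactor [c] is absorbed in the first factor, which stays a nonunit. *)
pose t := x * c :: s.
have nt y : y \in t -> maxideal y.
  rewrite inE => /orP[/eqP->|ys]; first by apply/maxidealM/ns/mem_head.
  by apply: ns; rewrite inE ys orbT.
have at_ : a = \prod_(y <- t) y.
  by rewrite ac !big_cons -!mulgA; congr (_ * _); rewrite cmulC.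
have tt y : y \in t -> atoms y.
  move=> yt; split=> [|b d yE]; first exact: nt.
  apply: contrapT => /not_orP[nb nd].
  suff /asboolP/kmax : deep k.+2 a by rewrite ltnn.
  have tE := perm_to_rem yt.
  exists [:: b, d & rem y t]; split=> [|w|].
  - by have := perm_size tE; rewrite /= ss => -[<-].
  - by rewrite !inE => /or3P[/eqP->|/eqP->|/mem_rem/nt].
  - by rewrite at_ (perm_big _ tE) !big_cons /= yE mulgA; exact: dvd_refl.
have -> : k.+1 = size t by rewrite /= ss.
rewrite at_; elim: (t) tt => [|y r IHr] tr.
  by rewrite big_nil; apply: short_unit; exact: units1.
rewrite big_cons /= -add1n; apply: shortM; first by apply/short_atom/tr/mem_head.
by apply: IHr => w wr; apply: tr; rewrite inE wr orbT.
Qed.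

Lemma red_atom_lift u : exists2 p, atoms p & cls p = val u.
Proof.
case: u => u /= /asboolP[nu au].
have uE : cls (repr u) = u by rewrite /cls reprK.
exists (repr u) => //; split=> [/units_cls|b c rE]; first by rewrite uE.
have /au[/units_cls|/units_cls] : u = cls b * cls c.
  + by rewrite -clsM -rE uE.
  + by left.
  + by right.
Qed.

Lemma factorization_lift (l : seq (red_atom H)) :
  exists s : seq H, [/\ size s = size l, forall x, x \in s -> atoms x
                      & cls (\prod_(x <- s) x) = \prod_(u <- l) val u].
Proof.
elim: l => [|u l [s [ss sat sE]]]; first by exists [::]; rewrite !big_nil.
have [p pat pE] := red_atom_lift u.
exists (p :: s); rewrite !big_cons clsM pE sE /= ss; split=> // x.
by rewrite inE => /orP[/eqP->|/sat].
Qed.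

(** Given a factorization [z] of a multiple of [u], the first [n] atoms of [z] (or
    all of them, if there are fewer) already have a product divisible by [u].
    Refactoring only this part, as [u] times a short factorization of the cofactor,
    keeps the rest of [z] unchanged. *)
Lemma tame_degree_le u p n B : cls p = val u ->
  (forall b, deep n b -> dvd p b) ->
  (forall s b, (size s <= n)%N -> (forall x, x \in s -> atoms x) ->
     \prod_(x <- s) x = p * b -> short B b) ->
  (tame_degree u <= Some (maxn n B.+1) :> enat)%O.
Proof.
move=> pE deep_p short_p; set D := maxn _ _.
rewrite /tame_degree; set A := [set _ | _].
suff AD : A (Some D) by case: (enat_infP (ex_intro _ _ AD)) => _; apply.
move=> a z [_ [/[swap] -[y _ <-]]] ua za.
have {ua} pa : dvd p a.
  apply/dvd_cls; exists (factorization_prod y).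
  by rewrite pE -[RHS]/(_ * _) -[val u]expg1 -factorization_prodn -factorization_prodD.
set l := enum_mset z; set z1 := seq_mset (take n l); set z2 := seq_mset (drop n l).
have zE : z = (z1 `+` z2)%mset.
  apply/msetP => w; rewrite msetE2 !mset_seqE -count_cat cat_take_drop.
  by rewrite count_mem_mset.
have [s [ss sat sE]] := factorization_lift (take n l).
have sn : (size s <= n)%N by rewrite ss size_take_min geq_minl.
have z1E : factorization_prod z1 = cls (\prod_(x <- s) x).
  by rewrite sE /factorization_prod (perm_big _ (perm_eq_seq_mset _)).
have [b bE] : dvd p (\prod_(x <- s) x).
  have [nl|ln] := leqP n (size l).
    apply: deep_p; exists s; split; last exact: dvd_refl.
      by rewrite ss size_takel.
    by move=> x /sat[].
  apply/dvd_cls; rewrite -z1E; suff -> : z1 = z by rewrite za; exact/dvd_cls.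
  by rewrite /z1 take_oversize 1?ltnW // seq_mset_id.
have [zb [zbE zbB]] := short_p _ _ sn sat bE.
exists ((u +` zb) `+` z2)%mset.
  split; last by exists (zb `+` z2)%mset => //; rewrite msetDA.
  rewrite /factorizations /= -za zE !factorization_prodD factorization_prodn.
  by rewrite expg1 zbE -pE z1E bE -[\pi_ _ b]/(cls b) clsM.
rewrite zE; apply: leq_trans (distanceDr _ _ _) _.
rewrite flengthD flengthn /D geq_max !leq_max add1n ltnS zbB orbT andbT.
by rewrite /flength (perm_size (perm_eq_seq_mset _)) -ss sn.
Qed.

End Factorization.

(** * Finiteness of Lambda and its consequences *)

Section Lambda.
Context {H : cmonoidType}.
Implicit Types (a b q : H) (u v : red_atom H).

Lemma short_min_length n a : short n a -> (min_length a <= Some n :> enat)%O.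
Proof.
move=> [z [za zn]].
have Az : [set (Some k : enat) | k in lengths a] (Some (flength z)).
  by exists (flength z) => //; exists z.
have [_ /(_ _ Az) le_z] := enat_infP (ex_intro _ _ Az).
by apply: Order.POrderTheory.le_trans le_z _; exact: zn.
Qed.

Lemma short_Lambda n : (forall a, short n a) -> (Lambda H <= Some n :> enat)%O.
Proof.
move=> sn; have [_] := enat_supP [set min_length a | a in [set: H]]; apply.
by move=> _ [a _ <-]; exact: short_min_length.
Qed.

Hypothesis sp : strongly_primary H.

Lemma short_exists a : exists n, short n a.
Proof.
have [n na] := finite_depth sp a; exists n; apply: not_deep_short => ?.
by apply: na; apply: deep_leq (leqnSn n) _.
Qed.

Lemma Lambda_short n : (Lambda H <= Some n :> enat)%O -> forall a, short n a.
Proof.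
move=> Ln a; have [m [z [za _]]] := short_exists a.
have Az : [set (Some k : enat) | k in lengths a] (Some (flength z)).
  by exists (flength z) => //; exists z.
have [[k [y ya yk] ak] _] := enat_infP (ex_intro _ _ Az).
exists y; split=> //; rewrite yk.
have [ub _] := enat_supP [set min_length a | a in [set: H]].
have := ub _ (imageP (@min_length H) (I : [set: H] a)); rewrite /min_length -ak.
by move=> /Order.POrderTheory.le_trans/(_ Ln).
Qed.

(** Split off the largest power of [q]; the cofactor is not divisible by [q], so it
    is shallow. *)
Lemma short_powers_Lambda q n : maxideal q -> (forall j, short n (q ^+ j)) ->
  exists N, forall a, short N a.
Proof.
move=> nq qn; have [M Mq] := strongly_primary_dvd sp nq.
exists (n + M)%N => a; have [k [b [-> nqb]]] := order_decomp sp a nq.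
apply: shortM => //; apply: not_deep_short => Mb; apply/nqb/Mq.
exact: deep_leq (leqnSn M) _.
Qed.

(** Passing from the factorization [q * ... * q] of [q ^+ k] to one that contains
    [u] replaces at most [N] copies of [q], and the replaced copies have the same
    product as atoms among which [u] occurs.  The exponent is [N.+1] because [u]
    may be [q] itself, in which case nothing is replaced. *)
Lemma tame_degree_dvd_exp u v p q k N :
  cls p = val u -> cls q = val v -> (tame_degree u <= Some N :> enat)%O ->
  dvd p (q ^+ k) -> dvd p (q ^+ N.+1).
Proof.
move=> pE qE uN [b qkE].
pose A := [set n : enat | forall a z,
    (factorizations a `&` multiples u !=set0)%classic -> factorizations a z ->
    exists2 z', (factorizations a `&` multiples u)%classic z'
              & (Some (distance z z') <= n :> enat)%O].
have A0 : A !=set0 by exists None => a z [y Ay] _; exists y.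
have [Au _] := enat_infP A0; rewrite -[enat_inf A]/(tame_degree u) in Au.
pose z := msetn k v.
have za : factorizations (q ^+ k) z.
  rewrite /factorizations /= factorization_prodn -qE -[RHS]/(cls _).
  elim: (k) => [|m IHm] //; by rewrite !expgS clsM IHm.
have [_ [y [yb _]]] := short_exists b.
have ua : (factorizations (q ^+ k) `&` multiples u)%classic (u +` y)%mset.
  split; last by exists y.
  rewrite /factorizations /= factorization_prodD factorization_prodn expg1 yb.
  by rewrite qkE -pE -[RHS]/(cls _) clsM.
have [z' [z'a [x _ z'E]] zz'] := Au _ _ (ex_intro _ _ ua) za.
have {uN zz'} : (distance z z' <= N)%N.
  exact: Order.POrderTheory.le_trans zz' uN.
rewrite /distance geq_max => /andP[zN _].
set g := (z `&` z')%mset in zN.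
have zE : z = (g `+` (z `\` g))%mset.
  by apply/msetP => w; rewrite !msetE2; lia.
have z'E2 : z' = (g `+` (z' `\` g))%mset.
  by apply/msetP => w; rewrite !msetE2; lia.
have rE : (z `\` g)%mset = msetn (flength (z `\` g)%mset) v.
  have rv w : w != v -> (z `\` g)%mset w = 0%N.
    by move=> wv; rewrite msetE2 msetnE (negbTE wv).
  have {2}-> : (z `\` g)%mset = msetn ((z `\` g)%mset v) v.
    by apply/msetP => w; rewrite msetnE; case: eqP => [->|/eqP/rv].
  rewrite flengthn; apply/msetP => w.
  by rewrite msetnE; case: eqP => [->|/eqP/rv].
have [ug|nug] := boolP (u \in g).
  have uv : u = v.
    apply/eqP; move: ug; rewrite in_msetI in_msetn => /andP[/andP[_ +] _].
    by rewrite eq_sym.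
  apply/dvd_cls; rewrite pE uv -qE; apply/dvd_cls.
  by rewrite -[X in dvd X _]expg1; exact: dvd_exp.
have uz' : (z' `\` g)%mset = (u +` (z' `\` g `\ u))%mset.
  rewrite msetB1K // in_msetB.
  have -> : g u = 0%N by apply/eqP; rewrite mset_eq0.
  by rewrite -z'E mset1DE eqxx.
apply: (@dvd_trans _ (q ^+ flength (z `\` g)%mset)); last first.
  by apply: dvd_exp; exact: leqW.
have pr : factorization_prod (z `\` g)%mset = factorization_prod (z' `\` g)%mset.
  apply: (@cmulI _ (factorization_prod g)).
  by rewrite -!factorization_prodD -zE -z'E2 za z'a.
apply/dvd_cls; rewrite pE.
have -> : cls (q ^+ flength (z `\` g)%mset) = factorization_prod (z `\` g)%mset.
  rewrite rE factorization_prodn -qE flengthn.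
  by elim: (flength _) => [|m IHm] //; rewrite !expgS clsM IHm.
by rewrite pr uz' factorization_prodD factorization_prodn expg1; exact: dvd_mulr.
Qed.

Lemma Lambda_locally_tame : (Lambda H < ∞)%O -> locally_tame H.
Proof.
case LE : (Lambda H) => [L|] // _ u.
have sL a : short L a by apply: Lambda_short; rewrite LE.
have [p [np _] pE] := red_atom_lift u.
have [M Mp] := strongly_primary_dvd sp np.
by apply: Order.POrderTheory.le_lt_trans (tame_degree_le pE Mp _) _.
Qed.

Lemma globally_tame_bound : globally_tame H ->
  exists N, forall u, (tame_degree u <= Some N :> enat)%O.
Proof.
rewrite /globally_tame; case sE : (enat_sup _) => [N|] // _; exists N => u.
have [ub _] := enat_supP [set tame_degree u | u in [set: red_atom H]].
by rewrite -sE; apply: ub; exists u.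
Qed.

Lemma globally_locally_tame : globally_tame H -> locally_tame H.
Proof.
move=> /globally_tame_bound[N uN] u.
exact: Order.POrderTheory.le_lt_trans (uN u) _.
Qed.

Lemma bound_globally_tame N :
  (forall u, (tame_degree u <= Some N :> enat)%O) -> globally_tame H.
Proof.
move=> uN; rewrite /globally_tame.
apply: (@Order.POrderTheory.le_lt_trans _ enat (Some N)) => //.
have [_] := enat_supP [set tame_degree u | u in [set: red_atom H]]; apply.
by move=> _ [u _ <-].
Qed.

Lemma exists_atom : exists q : H, atoms q.
Proof.
have [q nq] := strongly_primary_nonunit sp.
have [n [z [zq _]]] := short_exists q.
have [[|p s] [_ sat sE]] := factorization_lift (enum_mset z).
  case: nq; apply/units_cls; rewrite -[cls q]zq /factorization_prod -sE big_nil.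
  by apply/units_cls; exact: units1.
by exists p; apply: sat; exact: mem_head.
Qed.

(** A power [q ^+ k] is a product of at most Lambda atoms.  Under a uniform bound
    [N] each of them divides [q ^+ N.+1], which bounds [k]. *)
Lemma Lambda_not_globally_tame : (Lambda H < ∞)%O -> ~ globally_tame H.
Proof.
case LE : (Lambda H) => [L|] // _ /globally_tame_bound[N uN].
have sL a : short L a by apply: Lambda_short; rewrite LE.
have [q qat] := exists_atom; have nq := qat.1.
pose v : red_atom H := exist _ (cls q) (asboolT (atoms_cls qat)).
pose k := (N.+1 * L).+1.
have [z [zq zL]] := sL (q ^+ k).
have [s [ss sat sE]] := factorization_lift (enum_mset z).
have qs : dvd (q ^+ k) (\prod_(x <- s) x).
  by apply/dvd_cls; rewrite sE -[X in dvd _ X]/(factorization_prod z) zq; exact: dvd_refl.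
have sq : dvd (\prod_(x <- s) x) (q ^+ k).
  by apply/dvd_cls; rewrite sE -[X in dvd X _]/(factorization_prod z) zq; exact: dvd_refl.
have sN x : x \in s -> dvd x (q ^+ N.+1).
  move=> xs; pose u : red_atom H := exist _ (cls x) (asboolT (atoms_cls (sat x xs))).
  apply: (@tame_degree_dvd_exp u v x q k N) => //.
  apply: dvd_trans sq; rewrite (big_rem _ xs); exact: dvd_mulr.
have : dvd (\prod_(x <- s) x) (q ^+ (N.+1 * size s)).
  elim: (s) sN => [|x r IHr] rN; first by rewrite big_nil; exact: dvd1.
  rewrite big_cons mulnS expgnDr; apply: dvdM; first by apply/rN/mem_head.
  by apply: IHr => y yr; apply: rN; rewrite inE yr orbT.
move=> /(dvd_trans qs)/(dvd_exp_leq nq).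
by rewrite ss -/(flength z) /k ltnNge leq_mul.
Qed.

End Lambda.

(** * Almost divisibility and the conductor *)

Section AlmostDivisibility.
Context {H : cmonoidType}.
Implicit Types a b c q : H.

(** The fraction [b / a] lies in the complete integral closure. *)
Definition adv a b := exists c, forall n, dvd (a ^+ n) (c * b ^+ n).

Lemma expgM a b n : (a * b) ^+ n = a ^+ n * b ^+ n.
Proof. by apply: expgMn; exact: cmulC. Qed.

Lemma dvd_adv a b : dvd a b -> adv a b.
Proof. by move=> ab; exists 1 => n; rewrite mul1g; exact: dvdX. Qed.

Lemma adv_trans b a c : adv a b -> adv b c -> adv a c.
Proof.
move=> [d ab] [e bc]; exists (d * e) => n; apply: dvd_trans (ab n) _.
by rewrite -mulgA; apply: dvdM (bc n); exact: dvd_refl.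
Qed.

Lemma advM a b c d : adv a b -> adv c d -> adv (a * c) (b * d).
Proof.
move=> [e ab] [f cd]; exists (e * f) => n.
by rewrite !expgM cmulACA; exact: dvdM.
Qed.

Lemma advX a b n : adv a b -> adv (a ^+ n) (b ^+ n).
Proof.
move=> ab; elim: n => [|n IHn]; first by apply: dvd_adv; exact: dvd_refl.
by rewrite !expgS; exact: advM.
Qed.

Lemma advI c a b : adv (c * a) (c * b) -> adv a b.
Proof.
move=> [d ab]; exists d => n; have := ab n.
by rewrite !expgM cmulCA => /dvdI.
Qed.

(** The complete integral closure is root-closed: the remainder of [n] modulo [k]
    contributes a factor with the common denominator [a ^+ k]. *)
Lemma adv_root k a b : (0 < k)%N -> adv (a ^+ k) (b ^+ k) -> adv a b.
Proof.
move=> k0 [c ab]; exists (a ^+ k * c) => n.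
rewrite {1}(divn_eq n k) expgnDr cmulC -mulgA; apply: dvdM.
  by apply/dvd_exp/ltnW; rewrite ltn_mod.
rewrite mulnC expgnA; apply: dvd_trans (ab _) _; rewrite -expgnA.
by apply: dvdM (dvd_refl _) _; apply: dvd_exp; rewrite mulnC leq_trunc_div.
Qed.

Lemma cint_closureP a b : cint_closure (\pi_(qgroup H) (b, a)) <-> adv a b.
Proof.
have E c n : toq c * (\pi_(qgroup H) (b, a) : qgroup H) ^+ n
           = \pi_(qgroup H) (c * b ^+ n, a ^+ n).
  elim: n => [|n IHn]; first by rewrite expg0 !mulg1.
  rewrite expgSr mulgA IHn -[LHS]pi_q_mul /=.
  by rewrite -mulgA -!expgSr.
split=> [[c cP]|[c cP]]; exists c => n.
  case: n => [|n]; first by rewrite expg0; exact: dvd1.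
  have [//|d _] := cP n.+1; rewrite E => /pi_qP /=; rewrite mulg1 => dE.
  by exists d; rewrite -dE cmulC.
move=> _; have [d dE] := cP n; exists d => //; rewrite E.
by apply/pi_qP; rewrite /= mulg1 dE cmulC.
Qed.

Lemma conductor_neq0P :
  conductor H !=set0 <-> exists q, forall a b, adv a b -> dvd a (q * b).
Proof.
split=> [[f fP]|[q qP]].
  have adv11 : adv (1 : H) 1 by apply: dvd_adv; exact: dvd_refl.
  have [q _ qE] := fP _ (imageP _ ((cint_closureP 1 1).2 adv11)).
  exists q => a b /cint_closureP/(imageP (mul f))/fP[d _].
  have -> : f = toq q by rewrite qE -[RHS]/(f * 1) mulg1.
  rewrite -[RHS]pi_q_mul => /pi_qP /=; rewrite mulg1 mul1g => <-.
  by exists d; rewrite cmulC.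
exists (toq q) => _ [x xP <-]; move: xP; elim/quotW: x => -[b a].
move=> /cint_closureP/qP[d dE]; exists d => //; rewrite -[RHS]pi_q_mul.
by apply/pi_qP; rewrite /= mulg1 mul1g cmulC dE.
Qed.

End AlmostDivisibility.

(** * Nonempty conductor and infinite Lambda *)

Section Conductor.
Context {H : cmonoidType}.
Implicit Types a b c u : H.
Hypothesis sp : strongly_primary H.
Variable q : H.
Hypothesis nq : maxideal q.
Hypothesis advq : forall a b, adv a b -> dvd a (q * b).

(** Under a nonempty conductor the complete integral closure is completely
    integrally closed, the multiplier being corrected by [q]. *)
Lemma adv_complete c a b : (forall n, adv (a ^+ n) (c * b ^+ n)) -> adv a b.
Proof. by move=> ab; exists (q * c) => n; rewrite -mulgA; apply: advq. Qed.

Lemma dvd_power a : exists n, dvd a (q ^+ n).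
Proof.
have [/unitsP ua|na] := pselect (units a).
  by exists 0%N.
have [n an] := strongly_primary_dvd sp na.
by exists n; apply: an; have := deepX n (deep1 nq); rewrite mul1n.
Qed.

(** In terms of a valuation, [l / k] and [L / k] bound the value of [u] relative to
    that of [q] from below and from above. *)
Lemma adv_bounds u k : exists l L,
  [/\ adv (q ^+ l) (u ^+ k), ~ adv (q ^+ l.+1) (u ^+ k),
      adv (u ^+ k) (q ^+ L) & forall L', adv (u ^+ k) (q ^+ L') -> (L <= L')%N].
Proof.
have exL : exists L, `[< adv (u ^+ k) (q ^+ L) >].
  by have [n un] := dvd_power (u ^+ k); exists n; apply/asboolP/dvd_adv.
have exl : exists l, `[< adv (q ^+ l) (u ^+ k) >].
  by exists 0%N; apply/asboolP/dvd_adv/dvd1.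
have [n nn] := finite_order sp (q * u ^+ k) nq.
have ubl l : `[< adv (q ^+ l) (u ^+ k) >] -> (l <= n)%N.
  move=> /asboolP/advq ql; rewrite leqNgt; apply/negP => /ltnW nl.
  by apply: nn; apply: dvd_trans ql; exact: dvd_exp.
case: (ex_minnP exL) => L /asboolP uL Lmin.
case: (ex_maxnP exl ubl) => l /asboolP lu lmax.
exists l, L; split=> // [lu'|L' uL']; last by apply/Lmin/asboolP.
by have /lmax := asboolT lu'; rewrite ltnn.
Qed.

(** The difference [L - l] of the exponents of [adv_bounds] is bounded in [k],
    unless the powers of [q] have factorizations of bounded length.  A gap [d] makes
    [q ^+ d.+2] a product of two shallow elements, and consecutive gaps differ by at
    most [m], where [u] divides [q ^+ m]; so an unbounded gap produces short powers
    [q ^+ d.+2] in every window of length [m]. *)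
Lemma adv_gap_bounded u : ~ (exists n, forall j, short n (q ^+ j)) ->
  exists C, forall k, exists l, adv (q ^+ l) (u ^+ k) /\ adv (u ^+ k) (q ^+ (l + C)).
Proof.
move=> unb; apply: contra_notP unb => nC.
have [M Mq] := strongly_primary_dvd sp nq.
have short2 x : ~ dvd (q ^+ 2) x -> short (M * 2) x.
  move=> nx; apply: not_deep_short => xd; apply/nx/(deep_dvdX Mq).
  exact: deep_leq xd.
have [m um] := dvd_power u.
pose gap i k := exists l L,
  [/\ adv (q ^+ l) (u ^+ k), ~ adv (q ^+ l.+1) (u ^+ k), adv (u ^+ k) (q ^+ L),
      forall L', adv (u ^+ k) (q ^+ L') -> (L <= L')%N & (i + l < L)%N].
have exgap i : exists k, `[< gap i k >].
  apply: contra_notP nC => ngap; exists i => k.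
  have [l [L [ql nql uL Lmin]]] := adv_bounds u k.
  exists l; split=> //; apply: (adv_trans uL); apply/dvd_adv/dvd_exp.
  rewrite leqNgt; apply/negP => ilL; apply: ngap; exists k; apply/asboolP.
  by exists l, L; split; rewrite // addnC.
have window i : exists d, [/\ (i < d)%N, (d <= i + m)%N & short (M * 4) (q ^+ d.+2)].
  (* The first [k] whose gap exceeds [i]; the previous gap is at most [i]. *)
  case: (ex_minnP (exgap i)) => k /asboolP[l [L [ql nql uL Lmin ilL]]] kmin.
  case: k => [|k] in ql nql uL Lmin kmin *.
    have : adv (u ^+ 0) (q ^+ 0) by apply/dvd_adv/dvd_refl.
    by move=> /Lmin; lia.
  have [l' [L' [ql' nql' uL' Lmin']]] := adv_bounds u k.
  have {kmin} Ll' : (L' <= i + l')%N.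
    rewrite leqNgt; apply/negP => il'.
    suff /asboolP/kmin : gap i k by rewrite ltnn.
    by exists l', L'.
  have LL' : (L <= L' + m)%N.
    apply: Lmin; rewrite expgSr expgnDr.
    by apply: advM => //; exact: dvd_adv.
  have l'l : (l' <= l)%N.
    rewrite leqNgt; apply/negP => ll'; apply: nql.
    apply: (@adv_trans _ (q ^+ l')); first exact/dvd_adv/dvd_exp.
    by apply: adv_trans ql' _; apply/dvd_adv/dvd_exp.
  exists (L - l)%N; split; [lia|lia|].
  have [x xE] := advq ql; have [y yE] := advq uL.
  have -> : q ^+ (L - l).+2 = x * y.
    apply: (@cmulI _ (q ^+ l)); rewrite -expgnDr mulgA -xE.
    have -> : (l + (L - l).+2 = L.+2)%N by lia.
    by rewrite -mulgA -yE !expgS.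
  have -> : (M * 4 = M * 2 + M * 2)%N by lia.
  apply: shortM; apply: short2.
    move=> [w wE]; apply: nql; apply: (@advI _ q); apply/dvd_adv.
    exists w; rewrite xE wE expg2 expgS mulgA.
    by rewrite (cmulC (q ^+ l)) !mulgA.
  case: L => [|L] in ilL uL Lmin LL' yE *; first by [].
  move=> [w wE]; have /Lmin : adv (u ^+ k.+1) (q ^+ L).
    apply: (@advI _ (q ^+ 2)); apply/dvd_adv.
    exists w; rewrite expg2 -mulgA -expgS -expgS.
    by rewrite expgS yE wE expg2 cmulCA mulgA.
  by rewrite ltnn.
have [B Bq] := short_exists sp q.
exists (M * 4 + B * (m + 2))%N => j.
have [jm|mj] := leqP (m + 2) j; last first.
  by apply: short_leq (shortX j Bq); nia.
have [d [id dm dshort]] := window (j - (m + 2))%N.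
have -> : (j = d.+2 + (j - d.+2))%N by lia.
rewrite expgnDr; apply: short_leq (shortM dshort (shortX _ Bq)); nia.
Qed.

(** Every atom divides [q ^+ 4] and almost divides [q ^+ 3].  The former gives a
    bound [n], common to all atoms, on the number of atoms whose product is a
    multiple of a given one; the latter bounds the depth of products of at most [n]
    atoms, hence of all their divisors. *)
Lemma conductor_globally_tame : Lambda H = ∞ -> globally_tame H.
Proof.
move=> Linf; have unb : ~ (exists n, forall j, short n (q ^+ j)).
  move=> [n /(short_powers_Lambda sp nq)[N /short_Lambda]].
  by rewrite Linf.
have atom_dvd p : atoms p -> adv p (q ^+ 3) /\ dvd p (q ^+ 4).
  move=> [np pat]; suff pq : adv p (q ^+ 3) by split=> //; rewrite expgS; exact: advq.
  have nqp : ~ adv (q ^+ 3) p.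
    move=> /advq; rewrite expgS => /dvdI; rewrite expg2 => -[x].
    rewrite -mulgA => /pat[|/(dvd_units (dvd_mulr _ _))]; exact: nq.
  (* If [q ^+ 3] does not almost divide [p], it fails to do so at some power even
     after the correction by the bounded gap [C]; the comparison of [p ^+ n] with
     powers of [q] then turns around. *)
  have [C Cp] := adv_gap_bounded p unb.
  have [n nn] : exists n, ~ adv ((q ^+ 3) ^+ n) (q ^+ C * p ^+ n).
    by apply: contra_notP nqp => /forallNP all_n; apply: (@adv_complete (q ^+ C)) => n;
      apply: contrapT; exact: all_n.
  have [l [ql pl]] := Cp n.
  have n0 : (0 < n)%N.
    by case: n nn {ql pl} => // -[]; rewrite expg0; apply: dvd_adv; exact: dvd1.
  have l3 : (l + C <= 3 * n)%N.
    rewrite leqNgt; apply/negP => /ltnW l3; apply: nn; rewrite -expgnA.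
    apply: (@adv_trans _ (q ^+ (l + C))); first exact/dvd_adv/dvd_exp.
    rewrite expgnDr cmulC; apply: advM => //; exact/dvd_adv/dvd_refl.
  apply: (@adv_root _ n) => //; apply: adv_trans pl _.
  by rewrite -expgnA; exact/dvd_adv/dvd_exp.
have [M Mq] := strongly_primary_dvd sp nq.
set n := (M * 4)%N; pose B := (M * (3 * n).+2)%N.
apply: (@bound_globally_tame _ (maxn n B.+1)) => u.
have [p pat pE] := red_atom_lift u.
apply: tame_degree_le pE _ _ => [b nb|s b sn sat sE].
  apply: dvd_trans (atom_dvd p pat).2 _; exact: deep_dvdX nb.
apply: not_deep_short => /(deep_leq (leqnSn _))/(deep_dvdX Mq) qb.
have bs : dvd b (\prod_(x <- s) x) by rewrite sE; exact: dvd_mull.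
have sq : adv (\prod_(x <- s) x) (q ^+ (3 * size s)).
  elim: (s) sat => [|x r IHr] rat; first by rewrite big_nil; exact/dvd_adv/dvd1.
  rewrite big_cons mulnS expgnDr; apply: advM; first by apply: (atom_dvd _ _).1; apply/rat/mem_head.
  by apply: IHr => y yr; apply: rat; rewrite inE yr orbT.
have := dvd_trans qb (dvd_trans bs (advq sq)); rewrite -expgS.
by move=> /(dvd_exp_leq nq); lia.
Qed.

End Conductor.

(** * Domains with empty conductor *)

Section EmptyConductor.
Context {H : cmonoidType}.
Implicit Types a b q : H.
Hypothesis sp : strongly_primary H.

(** With [x = b / a], the number [n.+1] is the least exponent with [q ^+ n.+1 * x] in
    [H].  If no such [x] existed, the amount by which this least exponent exceeds
    [2 * i] would grow under squaring, whereas for [x] in the complete integral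
    closure it is bounded along all powers of [x]. *)
Lemma empty_conductor_square q i : maxideal q -> ~ (conductor H !=set0) ->
  exists a b n e, [/\ ~ dvd a (q ^+ n * b), dvd a (q ^+ n.+1 * b),
    dvd (a ^+ 2) (q ^+ e * b ^+ 2) & (e + 2 * i < 2 * n.+1)%N].
Proof.
move=> nq ncond; apply: contrapT => nsq.
have common a b : adv a b -> exists E, forall n, dvd (a ^+ n) (q ^+ E * b ^+ n).
  move=> [c ab]; have [E cE] := dvd_power sp nq c; exists E => n.
  by apply: dvd_trans (ab n) _; apply: dvdM cE (dvd_refl _).
have mono a b m n : (m <= n)%N -> dvd a (q ^+ m * b) -> dvd a (q ^+ n * b).
  move=> mn /dvd_trans; apply; apply: dvdM (dvd_refl _); exact: dvd_exp.
(* The excess over [2 * i] of the least exponent at least doubles under squaring;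
   growth by one at each squaring is enough below. *)
have step a b m : adv a b -> ~ dvd a (q ^+ (2 * i + m) * b) ->
    ~ dvd (a ^+ 2) (q ^+ (2 * i + m.+1) * b ^+ 2).
  move=> ab nab ab2; have [E abE] := common a b ab.
  have exN : exists N, `[< dvd a (q ^+ N * b) >].
    by exists E; apply/asboolP; exact: abE 1%N.
  case: (ex_minnP exN) => N /asboolP aN Nmin.
  have Nm : (2 * i + m < N)%N.
    by rewrite ltnNge; apply/negP => Nm; apply: nab; exact: mono aN.
  case: N => [|N] in aN Nmin Nm *; first by [].
  apply: nsq; exists a, b, N, (2 * i + m.+1)%N; split=> //.
    by move=> /asboolT/Nmin; rewrite ltnn.
  lia.
have [a [b [ab nab]]] : exists a b, adv a b /\ ~ dvd a (q ^+ (2 * i) * b).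
  apply: contra_notP ncond => nab; apply/conductor_neq0P; exists (q ^+ (2 * i)) => a b ab.
  by apply: contra_notP nab => ?; exists a, b.
have iter k : ~ dvd (a ^+ (2 ^ k)) (q ^+ (2 * i + k) * b ^+ (2 ^ k)).
  elim: k => [|k IHk]; first by rewrite addn0.
  by rewrite expnSr !expgnA; apply: step => //; exact: advX.
have [E abE] := common a b ab.
by apply: (iter E); apply: mono (abE _); exact: leq_addl.
Qed.

End EmptyConductor.

Section Domain.
Local Open Scope ring_scope.
Import GRing.Theory.
Context {R : idomainType}.
Implicit Types x y q : nonzero R.
Hypothesis sp : strongly_primary (nonzero R).

Definition to_nonzero (r : R) (r0 : r != 0) : nonzero R := Sub r r0.

Lemma val_to_nonzero r (r0 : r != 0) : val (to_nonzero r0) = r.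
Proof. exact: SubK. Qed.

Lemma val_nzM x y : val (x * y)%g = val x * val y.
Proof. by []. Qed.

Lemma val_nzX x n : val (x ^+ n)%g = val x ^+ n.
Proof. by elim: n => [|n IHn] //; rewrite expgS val_nzM IHn exprS. Qed.

(** Locality: if [1 - x] were a nonunit it would divide some power of [x], but it
    also divides [1 - x ^+ n]. *)
Lemma maxideal_one_sub x : maxideal x -> exists2 u : nonzero R, units u & val u = 1 - val x.
Proof.
move=> nx; have [x1|x1] := eqVneq (1 - val x) 0.
  case: nx; have -> : x = 1%g; last exact: units1.
  by apply: val_inj; move/eqP: x1; rewrite subr_eq0 => /eqP <-.
exists (to_nonzero x1); last exact: val_to_nonzero.
set u := to_nonzero x1; apply: contrapT => nu.
have [n un] := strongly_primary_dvd sp nu; apply: nu.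
have [v] : dvd u (x ^+ n)%g.
  by apply: un; have := deepX n (deep1 nx); rewrite mul1n.
move=> /(congr1 val); rewrite val_nzX val_nzM val_to_nonzero => xn.
have E : (1 - val x) * (val v + \sum_(i < n) val x ^+ i) = 1.
  by rewrite mulrDr -xn -[1 - _]opprB mulNr -subrX1 opprB addrC subrK.
have w0 : val v + \sum_(i < n) val x ^+ i != 0.
  by apply/eqP => w0; move/eqP: E; rewrite w0 mulr0 eq_sym oner_eq0.
by exists (to_nonzero w0); apply: val_inj; rewrite val_nzM !val_to_nonzero.
Qed.

(** With [a * y = q ^+ n.+1 * b] as in [empty_conductor_square], the factors
    [q ^+ i + y] and [q ^+ i - y] are not divisible by [q], as [q] divides [q ^+ i]
    but not [y]; and their product is [q ^+ (2 * i)] times [1 - q ^+ r * w], a unit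
    because [R] is local. *)
Lemma empty_conductor_short q M i : maxideal q -> ~ (conductor (nonzero R) !=set0) ->
  (forall b, deep M b -> dvd q b) -> (0 < i)%N -> short (M + M) (q ^+ (2 * i))%g.
Proof.
move=> nq ncond Mq i0.
have [a [b [n [e [nab [y yE] [w wE] ie]]]]] := empty_conductor_square sp i nq ncond.
have nqy : ~ dvd q y.
  move=> [d dE]; apply: nab; exists d; apply: (@cmulI _ q).
  by rewrite mulgA -expgS yE dE cmulCA.
pose r := (2 * n.+1 - e - 2 * i)%N.
have y2 : (y ^+ 2 = q ^+ (2 * i) * (q ^+ r * w))%g.
  apply: (@cmulI _ (a ^+ 2)%g); rewrite -expgM -yE expgM -expgnA.
  rewrite (cmulCA (a ^+ 2)%g) (cmulCA (a ^+ 2)%g) -wE.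
  rewrite (mulgA (q ^+ r)%g) -expgnDr (mulgA (q ^+ (2 * i))%g) -expgnDr.
  congr (_ ^+ _ * _)%g; rewrite /r; lia.
(* [s] is a sign, so that both factors are treated at once. *)
have shallow (s : R) : s ^+ 2 = 1 -> exists f : nonzero R,
    val f = val q ^+ i + s * val y /\ ~ dvd q f.
  move=> s2.
  have key c : val q ^+ i + s * val y = val q * c -> False.
    move=> E; have yE' : val y = val q * (s * (c - val q ^+ i.-1)).
      rewrite mulrCA mulrBr -exprS prednK // -E addrC addKr mulrA.
      by rewrite -expr2 s2 mul1r.
    have c0 : s * (c - val q ^+ i.-1) != 0.
      by apply/eqP => c0; have /eqP[] : val y != 0 := valP y; rewrite yE' c0 mulr0.
    apply: nqy; exists (to_nonzero c0); apply: val_inj.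
    by rewrite val_nzM val_to_nonzero.
  have f0 : val q ^+ i + s * val y != 0.
    by apply/eqP => f0; apply: (key 0); rewrite f0 mulr0.
  exists (to_nonzero f0); split; first by rewrite val_to_nonzero.
  by move=> [c /(congr1 val)]; rewrite val_to_nonzero => /key.
have [f [fE nqf]] := shallow 1 (expr1n _ _).
have [g [gE nqg]] := shallow (- 1) (etrans (sqrrN 1) (expr1n _ _)).
have shortM' x : ~ dvd q x -> short M x.
  by move=> nqx; apply: not_deep_short => /(deep_leq (leqnSn _))/Mq.
have [u uu uE] : exists2 u : nonzero R, units u & val u = 1 - val (q ^+ r * w)%g.
  apply: maxideal_one_sub; apply: maxidealM.
  have -> : r = r.-1.+1 by rewrite /r; lia.
  by rewrite expgS; exact: maxidealM.
have fg : (f * g = q ^+ (2 * i) * u)%g.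
  apply: val_inj; rewrite !val_nzM fE gE uE mul1r mulN1r mulrC -subr_sqr.
  by rewrite -!val_nzX y2 -expgnA (mulnC i) !val_nzM mulrBr mulr1.
apply: (@short_cls _ _ (f * g)%g); last by apply: shortM; exact: shortM'.
by apply/esym/pi_redP; exists u.
Qed.

Lemma empty_conductor_Lambda : ~ (conductor (nonzero R) !=set0) ->
  (Lambda (nonzero R) < ∞)%O.
Proof.
move=> ncond; have [q nq] := strongly_primary_nonunit sp.
have [M Mq] := strongly_primary_dvd sp nq.
have [B Bq] := short_exists sp q.
have [N sN] : exists N, forall a : nonzero R, short N a.
  apply: (short_powers_Lambda sp (n := (M + M + B)%N) nq) => j.
  have even i : short (M + M) (q ^+ (2 * i))%g.
    case: i => [|i]; last exact: empty_conductor_short.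
    by apply: short_leq (short_unit (@units1 _)).
  rewrite -(odd_double_half j) (addnC (odd j)) expgnDr -mul2n; apply: shortM (even _) _.
  case: odd => //.
  by apply: short_leq (short_unit (@units1 _)).
exact: Order.POrderTheory.le_lt_trans (short_Lambda sN) _.
Qed.

End Domain.

(** * Tameness of strongly primary monoids and domains *)

Theorem theorem3p9 :
  (forall H : cmonoidType, strongly_primary H ->
     [/\ (Lambda H < ∞)%O -> locally_tame H /\ ~ globally_tame H,
         Lambda H = ∞ -> conductor H !=set0 -> globally_tame H
       & (Lambda H < ∞)%O \/ conductor H !=set0 -> locally_tame H])
  /\
  (forall R : idomainType, strongly_primary (nonzero R) ->
     locally_tame (nonzero R) /\
     (globally_tame (nonzero R) <-> Lambda (nonzero R) = ∞)).
Proof.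
have finite_or_infinite (H : cmonoidType) : (Lambda H < ∞)%O \/ Lambda H = ∞.
  by case: (Lambda H) => [n|]; [left|right].
have glob (H : cmonoidType) : strongly_primary H ->
    Lambda H = ∞ -> conductor H !=set0 -> globally_tame H.
  move=> sp Linf /conductor_neq0P[q advq].
  have [p np] := strongly_primary_nonunit sp.
  apply: (@conductor_globally_tame _ sp (p * q)) => // [|a b ab].
    exact: maxidealM.
  by rewrite -mulgA; apply: dvd_trans (advq _ _ ab) (dvd_mull _ _).
have loc (H : cmonoidType) : strongly_primary H ->
    (Lambda H < ∞)%O \/ conductor H !=set0 -> locally_tame H.
  move=> sp; have [Lfin _|Linf [|cond]] := finite_or_infinite H.
  - exact: Lambda_locally_tame.
  - by rewrite Linf.
  - by apply: globally_locally_tame; exact: glob.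
split=> [H sp|R sp].
  split; [|exact: glob|exact: loc].
  move=> Lfin; split; first exact: Lambda_locally_tame.
  exact: Lambda_not_globally_tame.
have [cond|ncond] := pselect (conductor (nonzero R) !=set0).
  split; first by apply: loc => //; right.
  split=> [gt|Linf]; last exact: glob.
  have [Lfin|//] := finite_or_infinite (nonzero R).
  by have := Lambda_not_globally_tame sp Lfin gt.
have Lfin := empty_conductor_Lambda sp ncond.
split; first by apply: loc => //; left.
split=> [gt|Linf]; last by move: Lfin; rewrite Linf.
by have := Lambda_not_globally_tame sp Lfin gt.
Qed.
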